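(* Let $X$ and $Y$ be infinite-dimensional Banach spaces and let $A : X \to Y$ be a bounded linear operator of hybrid type. Then $A$ is not compact, and its null-space $\mathcal{N}(A)$ is uncomplemented in $X$.
   Context: $\mathcal{R}(A)$ and $\mathcal{N}(A)$ denote the range and null-space of $A$. A closed subspace $N$ of a Banach space $X$ is called complemented in $X$ if there is a closed subspace $U$ of $X$ with $X = N \oplus U$ (direct sum), and uncomplemented otherwise. A bounded linear operator $A : X \to Y$ between Banach spaces is called strictly singular if, for every infinite-dimensional subspace $M$ of $X$, the restriction of $A$ to $M$ is not an isomorphism (linear homeomorphism) onto its image. A bounded linear operator $A : X \to Y$ between infinite-dimensional Banach spaces is said to be of hybrid type if $A$ is strictly singular and its range $\mathcal{R}(A)$ contains an infinite-dimensional closed subspace of $Y$. *)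

(* Defs.v *)
From HB Require Import structures.
From mathcomp Require Import all_boot all_order all_algebra.
From mathcomp Require Import complex.
From mathcomp Require Import all_classical all_reals all_analysis.

Set Implicit Arguments.
Unset Strict Implicit.
Unset Printing Implicit Defensive.

Import Order.TTheory GRing.Theory Num.Theory.
Import numFieldNormedType.Exports.

Local Open Scope classical_set_scope.
Local Open Scope ring_scope.

(* Banach spaces are taken over the real or over the complex numbers; all the
   notions below make sense over any numFieldType of scalars. *)
Definition real_or_complex (R : realType) (K : numFieldType) : Prop :=
  K = (R : numFieldType) \/ K = (R[i] : numFieldType).

Section LinearSubspaces.
Context {K : numFieldType} {X : normedModType K}.
Implicit Types M N U : set X.

Definition linear_subspace M : Prop := submod_closed (mem M).

Definition finite_dimensional M : Prop :=
  exists n (e : 'I_n -> X),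
    M = range (fun c : 'I_n -> K => \sum_(i < n) c i *: e i).

Definition infinite_dimensional M : Prop := ~ finite_dimensional M.

Definition direct_sum_decomposition N U : Prop :=
  N `&` U = [set 0] /\
  [set: X] = [set x | exists2 n, N n & exists2 u, U u & x = n + u].

(* meant for a closed linear subspace N *)
Definition complemented N : Prop :=
  exists U, [/\ linear_subspace U, closed U & direct_sum_decomposition N U].

Definition uncomplemented N : Prop := ~ complemented N.

End LinearSubspaces.

Section Operators.
Context {K : numFieldType} {X Y : normedModType K}.
Implicit Type A : {linear X -> Y}.

Definition null_space A : set X := [set x | A x = 0].

(* the library's boundedness of linear maps, i.e. `|A x| <= r * `|x| for some r:
   see linear_boundedP *)
Definition bounded_operator A : Prop := bounded_near A (nbhs (0 : X)).

(* the restriction of A to M is a homeomorphism onto A @` M, for the topologies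
   induced by X and Y; B extends its inverse by arbitrary values *)
Definition isomorphism_onto_image A (M : set X) : Prop :=
  {within M, continuous A} /\
  exists B : Y -> X,
    (forall x, M x -> B (A x) = x) /\ {within A @` M, continuous B}.

Definition strictly_singular A : Prop :=
  forall M : set X, linear_subspace M -> infinite_dimensional M ->
    ~ isomorphism_onto_image A M.

Definition hybrid_type A : Prop :=
  strictly_singular A /\
  exists Z : set Y, [/\ linear_subspace Z, infinite_dimensional Z,
    closed Z & Z `<=` range A].

Definition compact_operator A : Prop :=
  forall B : set X, bounded_set B -> precompact (A @` B).

End Operators.

(* Main.v *)
Require Import Defs.
From HB Require Import structures.
From mathcomp Require Import all_boot all_order all_algebra.
From mathcomp Require Import complex.
From mathcomp Require Import all_classical all_reals all_analysis.
From mathcomp Require Import ring.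

Set Implicit Arguments.
Unset Strict Implicit.
Unset Printing Implicit Defensive.

Import Order.TTheory GRing.Theory Num.Theory.
Import numFieldNormedType.Exports.

Local Open Scope classical_set_scope.
Local Open Scope ring_scope.

(** Let [Z] be an infinite-dimensional closed subspace of [Y] contained in the
range of [A].  Both claims come from the open mapping theorem: if [W] is a
closed subspace of [X] whose image [A @` W] is closed, then every [y] in the
image is [A w] for some [w] in [W] with [`|w| <= c * `|y|], where [c] does not
depend on [y] ([open_mapping]).

- Take [W := A @^-1` Z].  The unit ball of [Z] lies in the image of a ball of
  [X].  If [A] were compact, the unit ball of [Z] would be compact, and [Z]
  would be finite-dimensional by Riesz's theorem
  ([compact_range_finite_dimensional]).

- Let [U] be a closed complement of the null-space and take
  [W := U `&` A @^-1` Z].  Its image is still [Z], because every value of [A]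
  is taken on [U], and [A] is injective on [W].  The bounded preimages then say
  that the inverse of [A] on [W] is continuous, so that [A] is an isomorphism
  from the infinite-dimensional [W] onto [Z]
  ([complemented_kernel_isomorphism]), against strict singularity.

The scalars enter in two ways only: they are archimedean, and every series
[\sum_k b_k / 2 ^+ k] with digits [b_k] in {0, 1} converges.  These two
properties hold for [R] and [R[i]], and everything else is proved from them for
a general field of scalars.  All limits are those of sequences whose errors are
at least halved at each step ([halving_cvg]). *)

(** * Geometric convergence *)

Definition archimedean (K : numFieldType) : Prop :=
  forall x : K, 0 <= x -> exists n, x <= n%:R.

(** The only form of completeness of the scalars that is needed for Riesz's
theorem.  A sum of this kind is real, so the complex case reduces to the real
one. *)
Definition dyadic_complete (K : numFieldType) : Prop :=
  forall b : nat -> bool, exists s : K, forall n,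
    `|\sum_(k < n) (b k)%:R / 2 ^+ k - s| <= 2 / 2 ^+ n.

Section Halving.
Context {K : numFieldType} (archiK : archimedean K).

Lemma halving_lt (a e : K) : 0 <= a -> 0 < e -> exists n, a / 2 ^+ n < e.
Proof.
move=> a0 e0; have [|n an] := @archiK (a / e); first by rewrite divr_ge0// ltW.
exists n; rewrite ltr_pdivrMr ?exprn_gt0// mulrC -ltr_pdivrMr//.
by rewrite (le_lt_trans an)// -natrX ltr_nat ltn_expl.
Qed.

Lemma halving_le0 (a : K) (x : K) :
  0 <= a -> (forall n, x <= a / 2 ^+ n) -> x <= 0.
Proof.
move=> a0 xa; apply/ler_addgt0Pr => e e0; rewrite add0r.
by have [n /ltW] := halving_lt a0 e0; exact: le_trans.
Qed.

Lemma halving_exp (r : nat -> K) :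
  (forall n, r n.+1 <= r n / 2) -> forall n, r n <= r 0%N / 2 ^+ n.
Proof.
move=> rS; elim=> [|n IH]; first by rewrite expr0 divr1.
by rewrite (le_trans (rS n))// exprSr invfM mulrA ler_pM2r.
Qed.

(** The bound by [r n / 2] on the steps makes [r n] itself an error bound: the
remaining steps add up to at most [r n / 2 + r n / 4 + ...].  Having the error
bound for every [n], not only the existence of the limit, is what lets one lemma
serve for nested balls, for successive approximations and for scalar series. *)
Lemma halving_cvg (X : completeNormedModType K) (u : nat -> X) (r : nat -> K) :
  (forall n, r n.+1 <= r n / 2) -> (forall n, `|u n.+1 - u n| <= r n / 2) ->
  exists l, forall n, `|u n - l| <= r n.
Proof.
move=> rS uS.
have r0 n : 0 <= r n.
  by have := le_trans (normr_ge0 _) (uS n); rewrite pmulr_lge0.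
(* Subtracting [r (n + m)] is what makes the induction on [m] go through. *)
have step m n : `|u (n + m)%N - u n| <= r n - r (n + m)%N.
  elim: m => [|m IH]; first by rewrite addn0 !subrr normr0.
  rewrite addnS -(subrKA (u (n + m)%N)) (le_trans (ler_normD _ _))//.
  rewrite (le_trans (lerD (uS _) IH))//.
  have -> : r (n + m)%N / 2 + (r n - r (n + m)%N) = r n - r (n + m)%N / 2.
    by field.
  by rewrite lerB.
have step' m n : `|u (n + m)%N - u n| <= r n.
  by rewrite (le_trans (step m n))// lerBlDr lerDl.
have : cvg (u @ \oo).
  apply/cauchy_cvgP/cauchy_exP => e e0.
  have [N rN] := halving_lt (r0 0%N) e0.
  exists (u N); exists N => //= n Nn.
  rewrite -ball_normE/= distrC -(subnKC Nn) (le_lt_trans (step' _ _))//.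
  by rewrite (le_lt_trans (halving_exp rS N)).
move=> /cvg_ex[l /cvgrPdist_lt ul]; exists l => n.
apply/ler_addgt0Pr => e e0; have [N _ /= uN] := ul e e0.
rewrite -(subrKA (u (n + N)%N)) (le_trans (ler_normD _ _))// lerD//.
  by rewrite distrC.
by rewrite distrC ltW// uN//= leq_addl.
Qed.

End Halving.

(** * Real and complex scalars *)

Lemma normc_real (R : realType) (x : R) :
  `|real_complex R x| = real_complex R `|x|.
Proof. by rewrite normc_def /= expr0n addr0 sqrtr_sqr. Qed.

Lemma real_or_complex_archimedean (R : realType) (K : numFieldType) :
  real_or_complex R K -> archimedean K.
Proof.
have archiR : archimedean R.
  by move=> x x0; exists (Num.bound x); exact/ltW/archi_boundP.
case=> -> // x; rewrite lecE => /andP[/= /eqP Imx Rex].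
have [n xn] := archiR _ Rex; exists n.
by rewrite -(rmorph_nat (real_complex R)) lecE/= Imx eqxx.
Qed.

Lemma real_or_complex_dyadic (R : realType) (K : numFieldType) :
  real_or_complex R K -> dyadic_complete K.
Proof.
have dyR : dyadic_complete R.
  move=> b; have archiR := @real_or_complex_archimedean R R (or_introl erefl).
  have [||l ul] := @halving_cvg R archiR R^o
    (fun n => \sum_(k < n) (b k)%:R / 2 ^+ k) (fun n => 2 / 2 ^+ n).
  - by move=> n; rewrite exprSr invfM mulrA.
  - move=> n; rewrite big_ord_recr/= addrAC subrr add0r ger0_norm ?divr_ge0//.
    rewrite [leRHS]mulrAC divff ?pnatr_eq0// ler_pM2r ?invr_gt0 ?exprn_gt0//.
    by case: (b n); [exact: lexx | exact: ler01].
  - by exists l.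
case=> -> // b; have [s sP] := dyR b; exists (real_complex R s) => n.
have := sP n; rewrite -lecR -normc_real rmorphB rmorph_sum/=.
rewrite fmorph_div rmorphXn rmorph_nat /=.
by under eq_bigr do rewrite fmorph_div rmorphXn !rmorph_nat.
Qed.

(** * Linear subspaces *)

Section Subspace.
Context {K : numFieldType} {X : normedModType K}.
Implicit Types M : set X.

Lemma linear_subspaceP M : linear_subspace M <->
  M 0 /\ forall a u v, M u -> M v -> M (a *: u + v).
Proof.
split=> -[M0 ML]; split.
- exact: set_mem M0.
- by move=> a u v Mu Mv; exact/set_mem/ML/mem_set/Mv/mem_set.
- exact/mem_set.
- by move=> a u v /set_mem Mu /set_mem Mv; exact/mem_set/ML.
Qed.

Lemma subspaceD M u v : linear_subspace M -> M u -> M v -> M (u + v).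
Proof.
by move=> /linear_subspaceP[_ ML] Mu Mv; rewrite -(scale1r u); apply: ML.
Qed.

Lemma subspaceZ M a u : linear_subspace M -> M u -> M (a *: u).
Proof.
by move=> /linear_subspaceP[M0 ML] Mu; rewrite -[_ *: _]addr0; apply: ML.
Qed.

Lemma subspaceB M u v : linear_subspace M -> M u -> M v -> M (u - v).
Proof.
by move=> lM Mu Mv; apply: subspaceD => //; rewrite -scaleN1r; apply: subspaceZ.
Qed.

Lemma subspace_sum M (I : finType) (f : I -> X) :
  linear_subspace M -> (forall i, M (f i)) -> M (\sum_i f i).
Proof.
move=> lM Mf; apply: big_ind => //; first by case/linear_subspaceP: lM.
by move=> u v; exact: subspaceD.
Qed.

Lemma closed_approx M l :
  closed M -> (forall e, 0 < e -> exists2 x, M x & `|l - x| < e) -> M l.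
Proof.
move=> cM Ml; apply: cM => B /nbhs_normP[e /= e0 eB].
by have [x Mx xe] := Ml e e0; exists x; split => //; exact: eB.
Qed.

End Subspace.

(** * The open mapping theorem on closed subspaces *)

Section OpenMapping.
Context {K : numFieldType} (archiK : archimedean K).

(** Baire's theorem in a closed subset [Z], in the form: some [C n] is dense in a
ball of [Z].  Otherwise one builds a sequence of balls centred in [Z], each with
at most half the radius of the preceding one, such that the ball of index
[n.+1] misses [C n]; the centres converge to a point of [Z] that lies in no
[C n].  Working with subsets of [Y] avoids making [Z] into a Banach space of its
own. *)
Lemma baire_closed (Y : completeNormedModType K) (Z : set Y)
    (C : nat -> set Y) :
  closed Z -> Z !=set0 -> Z `<=` \bigcup_n C n ->
  exists n z0 r, [/\ Z z0, 0 < r & forall z, Z z -> `|z - z0| < r ->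
    forall e, 0 < e -> exists2 c, C n c & `|z - c| < e].
Proof.
move=> cZ [y0 Zy0] ZC; apply: contrapT => noball.
have /choice[f fP] : forall p : nat * (Y * K), exists q : Y * K,
    Z p.2.1 -> 0 < p.2.2 ->
    [/\ Z q.1, 0 < q.2, `|q.1 - p.2.1| <= p.2.2 / 2, q.2 <= p.2.2 / 2 &
        forall c, C p.1 c -> ~ `|q.1 - c| <= q.2].
  move=> [n [z r]] /=.
  have [[Zz r0]|noZ] := pselect (Z z /\ 0 < r); last first.
    by exists (z, r) => Zz r0; case: noZ.
  have h0 : 0 < r / 2 by rewrite divr_gt0.
  apply: contrapT => nof; apply: noball; exists n, z, (r / 2); split => //.
  move=> z' Zz' z'z e e0; apply: contrapT => noc; apply: nof.
  have s0 : 0 < e + r / 2 by rewrite addr_gt0.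
  (* Half the harmonic mean of [e] and [r / 2]: it is below both of them, and
     needs no minimum in the partially ordered field [K]. *)
  exists (z', e * (r / 2) / (e + r / 2)) => _ _; split => //=.
  - by rewrite divr_gt0// mulr_gt0.
  - exact: ltW.
  - by rewrite ler_pdivrMr// mulrC ler_pM2l// lerDl ltW.
  - move=> c Cc z'c; apply: noc; exists c => //; apply: le_lt_trans z'c _.
    by rewrite ltr_pdivrMr// ltr_pM2l// ltrDr.
pose s := fix s n := if n is m.+1 then f (m, s m) else (y0, 1).
have s_ok n : Z (s n).1 /\ 0 < (s n).2.
  elim: n => [|n [Zs rs]]; first by split=> //=; exact: ltr01.
  by have [] := fP (n, s n) Zs rs.
have sP n := fP (n, s n) (s_ok n).1 (s_ok n).2.
have [||l ls] := @halving_cvg K archiK Y (fun n => (s n).1) (fun n => (s n).2).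
- by move=> n; have [] := sP n.
- by move=> n; have [] := sP n.
have Zl : Z l.
  apply: closed_approx => // e e0.
  have [n se] := halving_lt archiK ler01 e0.
  exists (s n).1; first exact: (s_ok n).1.
  rewrite distrC (le_lt_trans (ls n))// (le_lt_trans _ se)//.
  by apply: (halving_exp (r := fun n => (s n).2)) => m; have [] := sP m.
have [n _ Cl] := ZC l Zl.
by have [_ _ _ _ /(_ l Cl)] := sP n; apply; exact: (ls n.+1).
Qed.

Context {X Y : completeNormedModType K} (A : {linear X -> Y}).
Context (bndA : bounded_operator A).

Lemma bounded_operatorP : exists2 c, 0 <= c & forall x, `|A x| <= c * `|x|.
Proof.
move: bndA => /linear_boundedP[M [Mr AM]]; exists (`|M| + 1).
  by rewrite addr_ge0.
by apply: AM; rewrite (le_lt_trans (real_ler_norm Mr))// ltrDl.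
Qed.

Context {W : set X} (lW : linear_subspace W).
Context (cW : closed W) (cAW : closed (A @` W)).

(** By Baire, the images of the elements of norm at most [n] are dense in some
ball of the image, of centre [z0] and radius [r].  A small [z] is the difference
of [z0 + z] and [z0], both in that ball, so it is approximated by images of
elements of norm at most [2 * n].  Rescaling [z] to norm [r / 2] makes the error
proportional to the norm of [z]. *)
Lemma approximate_preimage : exists2 c, 0 <= c & forall z, (A @` W) z ->
  exists w, [/\ W w, `|w| <= c * `|z| & `|z - A w| <= `|z| / 2].
Proof.
have [W0 _] := (linear_subspaceP W).1 lW.
have [||n [z0 [r [[w0 Ww0 <-] r0 ballP]]]] := @baire_closed Y (A @` W)
    (fun n => A @` [set w | W w /\ `|w| <= n%:R]) cAW.
- by exists (A 0), 0.
- move=> _ [w Ww <-]; have [n wn] := archiK (normr_ge0 w).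
  by exists n => //; exists w.
exists (4 * n%:R / r); first by rewrite divr_ge0 ?mulr_ge0// ltW.
move=> _ [x Wx <-]; have [->|Ax0] := eqVneq (A x) 0.
  by exists 0; rewrite linear0 subr0 !normr0 mulr0 mul0r; split.
have nAx : 0 < `|A x| by rewrite normr_gt0.
pose t := r / 2 / `|A x|; have t0 : 0 < t by rewrite !divr_gt0.
(* Two errors of [r / 8] give [r / 4], half of the norm [r / 2] of [t *: A x]. *)
have e0 : 0 < r / 8 by rewrite divr_gt0.
have [_ [w1 [Ww1 w1n] <-] w1e] : exists2 y,
    (A @` [set w | W w /\ `|w| <= n%:R]) y
    & `|A (w0 + t *: x) - y| < r / 8.
  apply: ballP => //.
    by exists (w0 + t *: x) => //; apply: subspaceD => //; exact: subspaceZ.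
  rewrite linearD addrAC subrr add0r linearZ normrZ gtr0_norm//.
  by rewrite divfK ?gt_eqF// ltr_pdivrMr// ltr_pMr// ltr1n.
have [_ [w2 [Ww2 w2n] <-] w2e] : exists2 y,
    (A @` [set w | W w /\ `|w| <= n%:R]) y
    & `|A w0 - y| < r / 8.
  by apply: ballP => //; rewrite subrr normr0.
have wn : `|w1 - w2| <= 2 * n%:R.
  by rewrite mulr_natl mulr2n (le_trans (ler_normB _ _))// lerD.
have we : `|t *: A x - A (w1 - w2)| <= r / 4.
  have -> : t *: A x - A (w1 - w2) =
      (A (w0 + t *: x) - A w1) - (A w0 - A w2).
    rewrite [A (w1 - w2)]linearB [A (w0 + _)]linearD [A (t *: x)]linearZ /=.
    rewrite !opprB (addrC (A w0)) [in RHS]addrAC.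
    by rewrite -(addrA (t *: A x)) [A w0 + _]addrCA subrr addr0 addrA.
  rewrite (le_trans (ler_normB _ _))// (le_trans (lerD (ltW w1e) (ltW w2e)))//.
  by have -> : r / 8 + r / 8 = r / 4 by field.
have tn0 : t != 0 by rewrite gt_eqF.
have tV : `|t^-1| = 2 * `|A x| / r.
  rewrite ger0_norm ?invr_ge0 ?ltW// /t.
  by rewrite !invf_div mulrA (mulrC _ 2).
exists (t^-1 *: (w1 - w2)); split.
- by apply: subspaceZ => //; exact: subspaceB.
- rewrite normrZ tV.
  have -> : 4 * n%:R / r * `|A x| = 2 * `|A x| / r * (2 * n%:R) by ring.
  by rewrite ler_wpM2l// divr_ge0 ?mulr_ge0// ltW.
- rewrite [A (t^-1 *: _)]linearZ/= -[in `|A x - _|](scalerK tn0 (A x)).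
  rewrite -scalerBr normrZ tV.
  have -> : `|A x| / 2 = 2 * `|A x| / r * (r / 4) by field; rewrite (gt_eqF r0).
  by rewrite ler_wpM2l// divr_ge0 ?mulr_ge0// ltW.
Qed.

(** Approximate preimages of the successive residues, each at most half as large
as the preceding one, sum up to an exact preimage. *)
Lemma open_mapping : exists2 c, 0 <= c & forall z, (A @` W) z ->
  exists w, [/\ W w, A w = z & `|w| <= c * `|z|].
Proof.
have [c c0 cP] := approximate_preimage; have [d d0 dP] := bounded_operatorP.
have /choice[g gP] : forall z, exists w, (A @` W) z ->
    [/\ W w, `|w| <= c * `|z| & `|z - A w| <= `|z| / 2].
  move=> z; have [/cP[w wP]|nz] := pselect ((A @` W) z); first by exists w.
  by exists 0.
exists (2 * c); first by rewrite mulr_ge0.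
move=> z AWz; pose res n := iter n (fun y => y - A (g y)) z.
have resW n : (A @` W) (res n).
  elim: n => [//|n [x Wx xE]].
  exists (x - g (res n)); last by rewrite linearB xE.
  by apply: subspaceB => //; have [] := gP (res n); [exists x|].
have res_le n : `|res n| <= `|z| / 2 ^+ n.
  apply: (halving_exp (r := fun n => `|res n|)) => m.
  by have [] := gP _ (resW m).
pose u n := \sum_(k < n) g (res k).
have Au n : A (u n) = z - res n.
  elim: n => [|n IH]; first by rewrite /u big_ord0 linear0 subrr.
  by rewrite /u big_ord_recr/= linearD -/(u n) IH opprB addrA addrAC.
have Wu n : W (u n).
  by apply: subspace_sum => // k; have [] := gP _ (resW k).
have [||l ul] := @halving_cvg K archiK X u (fun n => 2 * c * `|z| / 2 ^+ n).
- by move=> n; rewrite exprSr invfM mulrA.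
- move=> n; rewrite /u big_ord_recr/= addrAC subrr add0r.
  have [_ gn _] := gP _ (resW n); rewrite (le_trans gn)//.
  have -> : 2 * c * `|z| / 2 ^+ n / 2 = c * (`|z| / 2 ^+ n).
    by field; rewrite expf_neq0// pnatr_eq0.
  exact: ler_wpM2l.
exists l; split.
- apply: closed_approx => // e e0.
  have [|n ne] := @halving_lt _ archiK (2 * c * `|z|) e _ e0.
    by rewrite !mulr_ge0.
  by exists (u n) => //; rewrite distrC (le_lt_trans (ul n)).
- apply/esym/eqP; rewrite -subr_eq0 -normr_le0.
  apply: (@halving_le0 _ archiK (`|z| + d * (2 * c * `|z|))) => [|n].
    by rewrite addr_ge0// !mulr_ge0.
  have -> : z - A l = res n + A (u n - l).
    by rewrite linearB Au addrA addrCA subrr addr0.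
  rewrite mulrDl (le_trans (ler_normD _ _))// lerD// (le_trans (dP _))//.
  by rewrite -[leRHS]mulrA ler_wpM2l.
- by have := ul 0%N; rewrite /u big_ord0 sub0r normrN expr0 divr1.
Qed.

End OpenMapping.

(** * Riesz's theorem *)

(** If the unit ball of [Z] has a finite [1/2]-net [e] in [Z], then every [z] of
the unit ball is within [1/2] of some [e i]; doubling the remainder gives a new
point of the unit ball, and iterating yields an expansion
[z = \sum_k 2 ^- k *: e (i_k)].  Collecting the terms with the same [e i] turns
it into a finite linear combination whose coefficients are dyadic series.  This
shows directly that [e] spans [Z], without using that finite-dimensional
subspaces are closed. *)
Lemma finite_net_finite_dimensional (K : numFieldType) (archiK : archimedean K)
    (dyK : dyadic_complete K) (Y : normedModType K) (Z : set Y)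
    (lZ : linear_subspace Z) (n : nat) (e : 'I_n -> Y) :
  (forall i, Z (e i)) ->
  (forall z, Z z -> `|z| <= 1 -> exists i, `|z - e i| <= 1 / 2) ->
  finite_dimensional Z.
Proof.
move=> Ze net; have [Z0 _] := (linear_subspaceP Z).1 lZ.
have [i0 _] : exists i, `|0 - e i| <= 1 / 2 by apply: net; rewrite ?normr0.
have /choice[idx idxP] : forall z, exists i,
    Z z -> `|z| <= 1 -> `|z - e i| <= 1 / 2.
  move=> z; have [[Zz z1]|nz] := pselect (Z z /\ `|z| <= 1).
    by have [i zi] := net z Zz z1; exists i.
  by exists i0 => Zz z1; case: nz.
have ball1 z : Z z -> `|z| <= 1 -> exists c : 'I_n -> K, z = \sum_i c i *: e i.
  move=> Zz z1; pose res k := iter k (fun y => 2 *: (y - e (idx y))) z.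
  have resP k : Z (res k) /\ `|res k| <= 1.
    elim: k => [//|k [Zk k1]]; split => /=.
      by apply: subspaceZ => //; exact: subspaceB.
    rewrite normrZ ger0_norm// (le_trans (ler_wpM2l _ (idxP _ Zk k1)))//.
    by rewrite mul1r divff// pnatr_eq0.
  have expansion m :
      z = \sum_(k < m) (2 ^+ k)^-1 *: e (idx (res k)) + (2 ^+ m)^-1 *: res m.
    elim: m => [|m IH]; first by rewrite big_ord0 add0r expr0 invr1 scale1r.
    rewrite {1}IH big_ord_recr/= -addrA; congr (_ + _).
    rewrite scalerA exprSr invfM mulrAC -mulrA divff ?pnatr_eq0// mulr1.
    by rewrite -scalerDr addrC subrK.
  have /choice[c cP] : forall i, exists s : K, forall m,
      `|\sum_(k < m) (idx (res k) == i)%:R / 2 ^+ k - s| <= 2 / 2 ^+ m.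
    by move=> i; exact: (dyK (fun k => idx (res k) == i)).
  exists c; apply/eqP; rewrite -subr_eq0 -normr_le0.
  apply: (@halving_le0 _ archiK (\sum_i 2 * `|e i| + 1)) => [|m].
    by rewrite addr_ge0// sumr_ge0// => i _; rewrite mulr_ge0.
  have regroup : \sum_(k < m) (2 ^+ k)^-1 *: e (idx (res k)) =
      \sum_i (\sum_(k < m) (idx (res k) == i)%:R / 2 ^+ k) *: e i.
    under [RHS]eq_bigr do rewrite scaler_suml.
    rewrite exchange_big/=; apply: eq_bigr => k _.
    rewrite (bigD1 (idx (res k)))//= eqxx mul1r big1 ?addr0// => i ik.
    by rewrite eq_sym (negbTE ik) mul0r scale0r.
  rewrite {1}(expansion m) regroup addrAC -sumrB (le_trans (ler_normD _ _))//.
  rewrite mulrDl lerD//.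
    rewrite (le_trans (ler_norm_sum _ _ _))// mulr_suml ler_sum// => i _.
    by rewrite -scalerBl normrZ mulrAC ler_wpM2r.
  have [_ rm] := resP m; rewrite normrZ mul1r ger0_norm ?invr_ge0 ?exprn_ge0//.
  by rewrite ler_piMr// invr_ge0 exprn_ge0.
exists n, e; apply/seteqP; split => [z Zz|_ [c _ <-]]; last first.
  by apply: subspace_sum => // i; exact: subspaceZ.
have [N zN] := archiK _ (normr_ge0 z).
(* [N.+1] rather than [N], so that the division is legitimate when [z = 0]. *)
have N0 : (N.+1%:R : K) != 0 by rewrite pnatr_eq0.
have [||c cE] := ball1 (N.+1%:R^-1 *: z).
- exact: subspaceZ.
- rewrite normrZ ger0_norm ?invr_ge0// mulrC ler_pdivrMr// mul1r.
  by rewrite (le_trans zN)// ler_nat.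
exists (fun i => N.+1%:R * c i) => //.
under eq_bigr do rewrite -scalerA.
by rewrite -scaler_sumr -cE scalerA divff// scale1r.
Qed.

(** * Operators and subspaces *)

Section Operators.
Context {K : numFieldType} {X Y : normedModType K} (A : {linear X -> Y}).

Lemma preimage_subspace (Z : set Y) :
  linear_subspace Z -> linear_subspace (A @^-1` Z).
Proof.
move=> /linear_subspaceP[Z0 ZL]; apply/linear_subspaceP; split.
  by rewrite /preimage/= linear0.
by move=> a u v Zu Zv; rewrite /preimage/= linearP; exact: ZL.
Qed.

Lemma image_finite_dimensional (M : set X) :
  finite_dimensional M -> finite_dimensional (A @` M).
Proof.
move=> [n [e ->]]; exists n, (A \o e); rewrite image_comp.
apply: eq_imagel => c _ /=.
by rewrite linear_sum; apply: eq_bigr => i _; rewrite linearZ.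
Qed.

(** The estimate makes [A] injective on [M] and its inverse Lipschitz on
[A @` M]. *)
Lemma bounded_inverse_isomorphism (M : set X) (c : K) :
  bounded_operator A -> linear_subspace M -> 0 <= c ->
  (forall x, M x -> `|x| <= c * `|A x|) -> isomorphism_onto_image A M.
Proof.
move=> bA lM c0 cP; split.
  by apply: continuous_subspaceT; exact/linear_bounded_continuous.
have /choice[B BP] : forall y, exists x, (A @` M) y -> M x /\ A x = y.
  move=> y; have [[x Mx xy]|ny] := pselect ((A @` M) y); first by exists x.
  by exists 0.
have BL y y' : (A @` M) y -> (A @` M) y' -> `|B y - B y'| <= c * `|y - y'|.
  move=> /BP[My Ey] /BP[My' Ey']; rewrite -{2}Ey -{2}Ey' -linearB.
  by apply: cP; exact: subspaceB.
exists B; split=> [x Mx|].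
  have AMx : (A @` M) (A x) by exists x.
  have [MB EB] := BP _ AMx.
  apply/eqP; rewrite -subr_eq0 -normr_le0.
  rewrite (le_trans (cP _ (subspaceB lM MB Mx)))//.
  by rewrite linearB EB subrr normr0 mulr0.
apply/subspace_continuousP => y AMy; apply/cvgrPdist_lt => e e0.
rewrite near_withinE; apply/nbhs_normP.
have c1 : 0 < c + 1 by rewrite ltr_wpDl.
exists (e / (c + 1)) => /=; first by rewrite divr_gt0.
move=> t; rewrite /ball_/= ltr_pdivlMr// mulrC => te AMt.
rewrite (le_lt_trans _ te)// (le_trans (BL _ _ AMy AMt))//.
by rewrite ler_wpM2r// lerDl.
Qed.

End Operators.

(** * Closed subspaces of the range *)

Lemma compact_range_finite_dimensional (K : numFieldType)
    (archiK : archimedean K) (dyK : dyadic_complete K)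
    (X Y : completeNormedModType K) (A : {linear X -> Y}) (Z : set Y) :
  bounded_operator A -> compact_operator A ->
  linear_subspace Z -> closed Z -> Z `<=` range A -> finite_dimensional Z.
Proof.
move=> bA cA lZ cZ ZA.
have contA : continuous A by exact/linear_bounded_continuous.
have imZ : A @` (A @^-1` Z) = Z.
  apply/seteqP; split => [_ [x Zx <-] //|z Zz].
  by have [x _ xz] := ZA z Zz; exists x => //; rewrite /preimage/= xz.
have lW := preimage_subspace A lZ.
have cW : closed (A @^-1` Z) by apply: closed_comp => // x _; exact: contA.
have [|c c0 cP] := open_mapping archiK bA lW cW; first by rewrite imZ.
rewrite imZ in cP.
pose D := [set z | Z z /\ `|z| <= 1].
have cD : compact D.
  have /cA : bounded_set [set x : X | `|x| <= c].
    exists c; split=> [|r cr x /= xc]; first exact: ger0_real.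
    exact: le_trans xc (ltW cr).
  rewrite precompactE => cAB; apply: (subclosed_compact _ cAB); last first.
    move=> z [Zz z1]; apply: subset_closure.
    have [w [_ wz wc]] := cP z Zz; exists w => //=.
    by rewrite (le_trans wc)// ler_piMr.
  apply: closedI => // l l1; apply/ler_addgt0Pr => e e0.
  have [x [/= x1 lx]] := l1 _ (nbhsx_ballx l e e0).
  rewrite -(subrK x l) addrC (le_trans (ler_normD _ _))// lerD//.
  by move: lx; rewrite -ball_normE => /ltW.
move: cD; rewrite compact_cover => /(_ Y D (fun y => ball y (1 / 2))).
case => [y _|z Dz|F FD DF].
- exact: ball_open.
- by exists z => //; exact: ballxx.
apply: (@finite_net_finite_dimensional _ archiK dyK _ _ lZ _
  (fun i : 'I_(size (finmap.enum_fset F)) => nth 0 (finmap.enum_fset F) i)).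
- by move=> i; have /set_mem[] := FD _ (mem_nth 0 (ltn_ord i)).
- move=> z Zz z1; have [y /= yF yz] := DF z (conj Zz z1).
  have yi : (index y (finmap.enum_fset F) < size (finmap.enum_fset F))%N.
    by rewrite index_mem.
  exists (Ordinal yi); rewrite /= nth_index//.
  by move: yz; rewrite -ball_normE/= distrC => /ltW.
Qed.

Lemma complemented_kernel_isomorphism (K : numFieldType)
    (archiK : archimedean K)
    (X Y : completeNormedModType K) (A : {linear X -> Y}) (Z : set Y) :
  bounded_operator A -> linear_subspace Z -> closed Z -> Z `<=` range A ->
  complemented (null_space A) ->
  exists M, [/\ linear_subspace M, A @` M = Z & isomorphism_onto_image A M].
Proof.
move=> bA lZ cZ ZA [U [lU cU [NU0 XNU]]].
have contA : continuous A by exact/linear_bounded_continuous.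
pose M := U `&` A @^-1` Z.
have lM : linear_subspace M.
  have /linear_subspaceP[U0 UL] := lU.
  have /linear_subspaceP[P0 PL] := preimage_subspace A lZ.
  apply/linear_subspaceP; split=> // a u v [Uu Pu] [Uv Pv].
  by split; [exact: UL | exact: PL].
have AM : A @` M = Z.
  apply/seteqP; split => [_ [x [_ Zx] <-] //|z Zz].
  have [x _ xz] := ZA z Zz.
  have : [set: X] x by []; rewrite XNU => -[n An [u Uu xE]].
  have Au : A u = z by rewrite -xz xE linearD An add0r.
  by exists u => //; split=> //; rewrite /preimage/= Au.
have cM : closed M.
  by apply: closedI => //; apply: closed_comp => // x _; exact: contA.
have [|c c0 cP] := open_mapping archiK bA lM cM; first by rewrite AM.
exists M; split=> //.
apply: (@bounded_inverse_isomorphism _ _ _ _ _ c) => // x Mx.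
have [|w [Mw wx wc]] := cP (A x); first by exists x.
suff <- : w = x by rewrite wx in wc *.
have : [set 0] (w - x).
  rewrite -NU0; split; first by rewrite /null_space/= linearB wx subrr.
  by apply: subspaceB; [| case: Mw | case: Mx].
by move=> /eqP; rewrite subr_eq0 => /eqP.
Qed.

Theorem proposition9 (R : realType) (K : numFieldType)
    (hK : real_or_complex R K)
    (X Y : completeNormedModType K)
    (hX : infinite_dimensional [set: X])
    (hY : infinite_dimensional [set: Y])
    (A : {linear X -> Y}) (hA : bounded_operator A) (hyb : hybrid_type A) :
  ~ compact_operator A /\ uncomplemented (null_space A).
Proof.
have archiK := real_or_complex_archimedean hK.
have [ssA [Z [lZ iZ cZ ZA]]] := hyb; split => [cA|cN].
  by apply: iZ; apply: (compact_range_finite_dimensional archiK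
    (real_or_complex_dyadic hK) hA cA lZ cZ ZA).
have [M [lM AM isoM]] := complemented_kernel_isomorphism archiK hA lZ cZ ZA cN.
apply: (ssA M lM _ isoM) => fM; apply: iZ.
by rewrite -AM; exact: image_finite_dimensional.
Qed.
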